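(* Let $X$ be a complete metric space with a positive $\sigma$-finite measure $\mu$, $\Omega$ a relatively compact connected domain in $X$, $p\ge1$, and $D$ a linear operator acting on $\mathbb{C}^p$-valued functions. Let $\tau>0$, $s\in(1,\infty)$, and let $K$ be a subspace of $L^{s'}_p(\Omega)$, $s'$ the conjugate exponent of $s$. Assume: (i) (Local Increasing Regularity) for every $x\in\bar\Omega$ there is $R>0$ such that, with $B:=B(x,R)$ and $B^1:=B(x,R/2)$, for every $r\ge s$ there is $c_l>0$ such that for all $u\in L^r_p(B)$, $$\|u\|_{L^t_p(B^1)}\le c_l\big(\|Du\|_{L^r_p(B)}+\|u\|_{L^r_p(B)}\big),\qquad \tfrac1t=\tfrac1r-\tau;$$ (ii) (Global resolvability) there is $c_g>0$ such that for every $\omega\in L^s_p(\Omega)$ with $\omega\perp K$ there is $w$ with $Dw=\omega$ in $\Omega$ and $\|w\|_{L^s_p(\Omega)}\le c_g\|\omega\|_{L^s_p(\Omega)}$. Then there is a constant $c_f>0$ such that for $r\ge s$, if $\omega\in L^r_p(\Omega)$ and $\omega\perp K$, there is a $u\in L^t_p(\Omega)$ with $\frac1t=\frac1r-\tau$ such that $Du=\omega$ and $\|u\|_{L^t_p(\Omega)}\le c_f\|\omega\|_{L^r_p(\Omega)}$. If moreover $X$ is a manifold (of dimension $n$) which admits the Sobolev embedding theorems, and for some $\alpha>0$ the following hold: (i') for every $x\in\bar\Omega$ there is $R>0$ such that for every $r\ge s$ there is $c_l>0$ such that for all $u\in L^r_p(B)$, $\|u\|_{W^{\alpha,r}_p(B^1)}\le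 c_l(\|Du\|_{L^r_p(B)}+\|u\|_{L^r_p(B)})$, with $B=B(x,R)$, $B^1=B(x,R/2)$; (ii') there is $c_g>0$ such that for every $\omega\in L^s_p(\Omega)$ with $\omega\perp K$ there is $w$ with $Dw=\omega$ in $\Omega$ and $\|w\|_{W^{\alpha,s}_p(\Omega)}\le c_g\|\omega\|_{L^s_p(\Omega)}$; then $u\in W^{\alpha,r}_p(\Omega)$ with control of the norm, i.e. $\|u\|_{W^{\alpha,r}_p(\Omega)}\le c\|\omega\|_{L^r_p(\Omega)}$ for a constant $c$ independent of $\omega$.
   Context: $E^p(\Omega)$ is the set of $\mathbb{C}^p$-valued functions $\omega=(\omega_1,\dots,\omega_p)$ on $\Omega$, with pointwise norm $|\omega(x)|^2=\sum_j|\omega_j(x)|^2$, and $L^r_p(\Omega)$ is the space of those with $\|\omega\|^r_{L^r_p(\Omega)}=\int_\Omega|\omega|^rd\mu<\infty$; pairing $\langle\omega,\omega'\rangle=\int_\Omega\sum_j\omega_j\overline{\omega'_j}\,d\mu$, and $\omega\perp K$ means $\langle\omega,k\rangle=0$ for all $k\in K$ ($K=\{0\}$ is allowed, meaning no constraint). $D=D_p$ is a linear operator on $E^p$, i.e. a matrix whose entries are linear operators on functions; it acts on functions on $\Omega$ and on functions on the balls occurring in (i), compatibly with restriction. $B(x,R)$ is the metric ball. The relation $\frac1t=\frac1r-\tau$ is understood for exponents with $\frac1r-\tau>0$. $W^{\alpha,r}_p$ denotes the Sobolev space of order $\alpha$ over $L^r_p$; 'admits the Sobolev embedding theorems' means that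 $W^{\alpha,q}_p(B)$ embeds continuously in $L^{\kappa}_p(B)$, $\frac1\kappa=\frac1q-\frac\alpha n$ (when this is positive), on the balls $B$ under consideration.
   Formalization: The constant c_f may depend on r; the balls B, B^1 in (i), (i') are B(x,R)∩Ω, B(x,R/2)∩Ω, with u defined there only; and μ(Ω)<∞ is assumed. As literally stated (c_f uniform in r, full balls at the boundary, arbitrary σ-finite μ) the claim can fail. *)

(* Defs.v *)
From HB Require Import structures.
From mathcomp Require Import all_boot all_order all_algebra.
From mathcomp Require Import complex.
From mathcomp Require Import all_classical all_reals all_analysis.

Set Implicit Arguments.
Unset Strict Implicit.
Unset Printing Implicit Defensive.

Import Order.TTheory GRing.Theory Num.Theory.
Import numFieldNormedType.Exports.

Local Open Scope classical_set_scope.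
Local Open Scope ring_scope.

Notation borel X := (g_sigma_algebraType (@open X)).

#[short(type="completeMetricType")]
HB.structure Definition CompleteMetric (R : numDomainType) :=
  { M of Metric R M & Complete M }.

(** ** C^p-valued functions and L^r_p

   A function on a set [U] is represented by a total function of which only
   the values on [U] matter. *)

Definition cnorm (R : realType) (p : nat) (z : 'rV[R[i]]_p) : R :=
  Num.sqrt (\sum_(j < p) (complex.Re (z 0 j) ^+ 2 + complex.Im (z 0 j) ^+ 2)).

Section Lebesgue_spaces.
Context (R : realType) (d : measure_display) (T : measurableType d).
Variables (mu : {measure set T -> \bar R}) (p : nat).
Implicit Types (U : set T) (u v : T -> 'rV[R[i]]_p).

Definition cmeasurable U u : Prop :=
  forall j, measurable_fun U (fun x => complex.Re (u x 0 j)) /\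
            measurable_fun U (fun x => complex.Im (u x 0 j)).

Definition Lr_norm U (r : R) u : \bar R :=
  'N[mu]_(r%:E)[(fun x => (cnorm (u x))%:E) \_ U].

Definition Lr_space U (r : R) u : Prop :=
  cmeasurable U u /\ (Lr_norm U r u < +oo)%E.

Definition cintegral U (f : T -> R[i]) : R[i] :=
  Complex (Rintegral mu U (fun x => complex.Re (f x)))
          (Rintegral mu U (fun x => complex.Im (f x))).

Definition pairing U u v : R[i] :=
  cintegral U (fun x => \sum_(j < p) u x 0 j * conjc (v x 0 j)).

Definition orthogonal_to U u (K : set (T -> 'rV[R[i]]_p)) : Prop :=
  forall k, K k -> pairing U u k = 0.

Definition ae_eq_on U u v : Prop := {ae mu, forall x, U x -> u x = v x}.

End Lebesgue_spaces.

Definition subspace_of (R : realType) (T : Type) (p : nat)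
    (K E : set (T -> 'rV[R[i]]_p)) : Prop :=
  [/\ K `<=` E, K (fun=> 0) &
      forall (a : R[i]) u v, K u -> K v -> K (fun x => a *: u x + v x)].

(** ** The operator D

   [op D U] acts on the functions on the open set [U] that lie in the linear
   space [dom D U]; an everywhere defined operator is the case where [dom D U]
   is everything, and a differential operator has as domain the functions for
   which [Du] (in the weak sense) is a function. Functions [Du] are determined
   up to null sets. A linear map on C^p-valued functions is the same thing as
   a p x p matrix of linear maps on scalar functions. *)

Record operator (R : realType) (X : completeMetricType R)
    (mu : {measure set (borel X) -> \bar R}) (p : nat) := Operator {
  dom : set X -> set (X -> 'rV[R[i]]_p);
  op : set X -> (X -> 'rV[R[i]]_p) -> X -> 'rV[R[i]]_p;
  dom_zero : forall U, open U -> dom U (fun=> 0);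
  op_linear : forall U (a : R[i]) u v, open U -> dom U u -> dom U v ->
    dom U (fun x => a *: u x + v x) /\
    ae_eq_on mu U (op U (fun x => a *: u x + v x))
                  (fun x => a *: op U u x + op U v x);
  op_local : forall U u v, open U -> (forall x, U x -> u x = v x) ->
    dom U u -> dom U v /\ ae_eq_on mu U (op U u) (op U v);
  op_restrict : forall U V u, open U -> open V -> V `<=` U ->
    dom U u -> dom V u /\ ae_eq_on mu V (op V u) (op U u) }.

Definition solves (R : realType) (X : completeMetricType R)
    (mu : {measure set (borel X) -> \bar R}) (p : nat)
    (D : operator mu p) (U : set X) (u f : X -> 'rV[R[i]]_p) : Prop :=
  dom D U u /\ ae_eq_on mu U (op D U u) f.

(** ** Local increasing regularity and global resolvability

   All functions live on [Omega]: the ball of radius [rho] centred at a point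
   [x] of the closure of [Omega] is the trace on [Omega] of the metric ball of
   the ambient space (the two agree as soon as the latter lies in [Omega]).
   In the local estimates [f] stands for [Du]; when [Du] is not in [L^r] the
   right-hand side is infinite and there is nothing to require. *)

Definition rball (R : realType) (X : completeMetricType R) (Omega : set X)
    (x : X) (rho : R) : set X := ball x rho `&` Omega.

Section Hypotheses.
Context (R : realType) (X : completeMetricType R).
Variables (mu : {measure set (borel X) -> \bar R}) (p : nat).
Variables (D : operator mu p) (Omega : set X).

Definition local_estimate (N : set X -> (X -> 'rV[R[i]]_p) -> \bar R)
    (B B1 : set X) (r : R) : Prop :=
  exists2 c : R, 0 < c & forall u f, Lr_space mu B r u -> solves D B u f ->
    Lr_space mu B r f ->
    (N B1 u <= c%:E * (Lr_norm mu B r f + Lr_norm mu B r u))%E.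

Definition local_increasing_regularity (tau s : R) : Prop :=
  forall x, closure Omega x -> exists2 rho : R, 0 < rho &
    forall r, s <= r -> 0 < r^-1 - tau ->
      local_estimate (fun B1 => Lr_norm mu B1 (r^-1 - tau)^-1)
        (rball Omega x rho) (rball Omega x (rho / 2)) r.

Definition global_resolvability (N : (X -> 'rV[R[i]]_p) -> \bar R)
    (s : R) (K : set (X -> 'rV[R[i]]_p)) : Prop :=
  exists2 c : R, 0 < c & forall omega, Lr_space mu Omega s omega ->
    orthogonal_to mu Omega omega K ->
    exists w, [/\ Lr_space mu Omega s w, solves D Omega w omega &
                  (N w <= c%:E * Lr_norm mu Omega s omega)%E].

End Hypotheses.

(** ** Sobolev spaces on open subsets of R^n *)

(* The Lebesgue measure is the only Borel measure giving each box its volume. *)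
Definition is_lebesgue (R : realType) (n : nat)
    (vol : {measure set (borel 'rV[R]_n) -> \bar R}) : Prop :=
  forall a b : 'rV[R]_n, (forall i, a 0 i <= b 0 i) ->
    vol [set x | forall i, a 0 i <= x 0 i <= b 0 i]
    = (\prod_(i < n) (b 0 i - a 0 i))%:E.

(* [pderiv [:: i1; ..; im] f] is the iterated partial derivative
   d_i1 (.. (d_im f)); such words replace multi-indices. *)
Definition pderiv (R : realType) (n : nat) (V : normedModType R)
    (w : seq 'I_n) (f : 'rV[R]_n -> V) : 'rV[R]_n -> V :=
  foldr (fun i g => 'D_(delta_mx 0 i) g) f w.

Definition smooth_on (R : realType) (n : nat) (V : normedModType R)
    (O : set 'rV[R]_n) (f : 'rV[R]_n -> V) : Prop :=
  forall (w : seq 'I_n) x, O x -> {for x, continuous (pderiv w f)} /\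
    forall i, derivable (pderiv w f) x (delta_mx 0 i).

Definition test_function (R : realType) (n : nat) (O : set 'rV[R]_n)
    (phi : 'rV[R]_n -> R) : Prop :=
  smooth_on setT phi /\
  exists C, [/\ compact C, C `<=` O & forall x, ~ C x -> phi x = 0].

Section Euclidean_Sobolev.
Context (R : realType) (n : nat).
Variables (vol : {measure set (borel 'rV[R]_n) -> \bar R}) (p : nat).
Implicit Types (O : set 'rV[R]_n) (v g : 'rV[R]_n -> 'rV[R[i]]_p).

Definition cloc_integrable O g : Prop :=
  @cmeasurable R _ (borel 'rV[R]_n) p O g /\
  forall C, compact C -> C `<=` O -> (\int[vol]_(x in C) (cnorm (g x))%:E < +oo)%E.

Definition weak_derivative O (w : seq 'I_n) v g : Prop :=
  [/\ cloc_integrable O v, cloc_integrable O g &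
    forall phi, test_function O phi -> forall j,
      cintegral vol O
        (fun x => v x 0 j * real_complex R (pderiv w phi x))
      = (-1) ^+ size w *
        cintegral vol O
          (fun x => g x 0 j * real_complex R (phi x))].

Definition weak_derivatives O (k : nat) v
    (G : seq 'I_n -> 'rV[R]_n -> 'rV[R[i]]_p) : Prop :=
  forall w, (size w <= k)%N -> weak_derivative O w v (G w).

(* Sobolev-Slobodeckij seminorm of order [sigma] in (0, 1); at [x = y] the
   quotient is 0 *)
Definition slobodeckij O (sigma r : R) g : \bar R :=
  ((\int[vol]_(x in O) \int[vol]_(y in O)
     (cnorm (g x - g y) `^ r / `|x - y| `^ (n%:R + sigma * r))%:E) `^ r^-1)%E.

Definition sobolev_sum O (alpha r : R)
    (G : seq 'I_n -> 'rV[R]_n -> 'rV[R[i]]_p) : \bar R :=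
  let k := Num.truncn alpha in
  (\sum_(m < k.+1) \sum_(w : m.-tuple 'I_n) Lr_norm vol O r (G w) +
   if alpha == k%:R then 0
   else \sum_(w : k.-tuple 'I_n) slobodeckij O (alpha - k%:R) r (G w))%E.

(* Weak derivatives are unique up to null sets, so the supremum is over a
   one-element set; the norm is infinite if [v] has no weak derivatives. *)
Definition sobolev_norm O (alpha r : R) v : \bar R :=
  let W := [set G | weak_derivatives O (Num.truncn alpha) v G] in
  if `[< W !=set0 >] then ereal_sup [set sobolev_sum O alpha r G | G in W]
  else +oo%E.

End Euclidean_Sobolev.

(** ** Manifolds and their Sobolev spaces *)

Record chart (R : realType) (X : topologicalType) (n : nat) := Chart {
  chart_dom : set X;
  chart_map :> X -> 'rV[R]_n;
  chart_inv : 'rV[R]_n -> X;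
  chart_dom_open : open chart_dom;
  chart_img_open : open (chart_map @` chart_dom);
  chart_mapK : forall x, chart_dom x -> chart_inv (chart_map x) = x;
  chart_map_continuous : {within chart_dom, continuous chart_map};
  chart_inv_continuous :
    {within chart_map @` chart_dom, continuous chart_inv} }.

Definition smooth_atlas (R : realType) (X : topologicalType) (n : nat)
    (A : set (chart R X n)) : Prop :=
  (forall x, exists2 c, A c & chart_dom c x) /\
  (forall c c', A c -> A c' ->
     smooth_on (c @` (chart_dom c `&` chart_dom c')) (c' \o chart_inv c)).

(* A finite family of charts [ch i], shrunk to relatively compact [V i], covering
   a compact set: the data in terms of which Sobolev norms on a manifold are
   defined. Different choices give equivalent norms on subsets of [Omega]. *)
Definition chart_cover (R : realType) (X : topologicalType) (n m : nat)
    (A : set (chart R X n)) (Omega : set X)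
    (ch : 'I_m -> chart R X n) (V : 'I_m -> set X) : Prop :=
  (forall i, [/\ A (ch i), open (V i), compact (closure (V i)) &
                 closure (V i) `<=` chart_dom (ch i)]) /\
  closure Omega `<=` \bigcup_(i in setT) V i.

Section Manifold_Sobolev.
Context (R : realType) (X : completeMetricType R) (n m : nat).
Variables (mu : {measure set (borel X) -> \bar R}) (p : nat).
Variable vol : {measure set (borel 'rV[R]_n) -> \bar R}.
Variables (ch : 'I_m -> chart R X n) (V : 'I_m -> set X).

(* The first term places the space inside L^r(mu); the derivatives are measured
   in charts with the Lebesgue measure, which on the relatively compact [V i] is
   equivalent to [mu] whenever [mu] has a continuous positive density. *)
Definition Wnorm (alpha : R) (U : set X) (r : R) (u : X -> 'rV[R[i]]_p)
  : \bar R :=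
  (Lr_norm mu U r u +
   \sum_(i < m) sobolev_norm vol (ch i @` (U `&` V i)) alpha r
                  (u \o chart_inv (ch i)))%E.

Definition Wspace (alpha : R) (U : set X) (r : R) (u : X -> 'rV[R[i]]_p)
  : Prop :=
  Lr_space mu U r u /\ (Wnorm alpha U r u < +oo)%E.

Definition sobolev_embedding (alpha : R) (U : set X) : Prop :=
  forall q : R, 1 < q -> 0 < q^-1 - alpha / n%:R ->
    exists2 c : R, 0 < c & forall u, Wspace alpha U q u ->
      (Lr_norm mu U (q^-1 - alpha / n%:R)^-1 u
       <= c%:E * Wnorm alpha U q u)%E.

Definition local_sobolev_regularity (D : operator mu p) (Omega : set X)
    (alpha s : R) : Prop :=
  forall x, closure Omega x -> exists2 rho : R, 0 < rho &
    [/\ sobolev_embedding alpha (rball Omega x rho),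
        sobolev_embedding alpha (rball Omega x (rho / 2)) &
        forall r, s <= r ->
          local_estimate D (fun B1 => Wnorm alpha B1 r)
            (rball Omega x rho) (rball Omega x (rho / 2)) r].

End Manifold_Sobolev.

(* Main.v *)
Require Import Defs.
From HB Require Import structures.
From mathcomp Require Import all_boot all_order all_algebra.
From mathcomp Require Import complex ring lra.
From mathcomp Require Import all_classical all_reals all_analysis measurable_realfun.

Set Implicit Arguments.
Unset Strict Implicit.
Unset Printing Implicit Defensive.

Import Order.TTheory GRing.Theory Num.Theory.
Import numFieldNormedType.Exports.

Local Open Scope classical_set_scope.
Local Open Scope ring_scope.

(** The solution is the one that global resolvability provides in L^s; what has
   to be shown is that it is automatically as regular as [omega] permits.
   Since [Omega] has finite measure and [r >= s], [omega] lies in L^s and there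
   is [w] with [D w = omega] and [w] bounded in L^s.

   Raising steps. If [w] is bounded in L^q with [s <= q <= r], the local
   estimate bounds [w] in L^(1/(1/q - tau)) on half-radius balls around all
   points of the compact closure of [Omega]; finitely many of them cover
   [Omega], so the bound holds on all of [Omega] ([controls_norm_step]). Each
   step lowers [1/q] by the fixed amount [tau], hence finitely many reach
   [q = r], and one more step gives the exponent [t]
   ([controls_norm_bootstrap]).

   Sobolev norms. Here [w] is taken bounded in W^(alpha,s). By the raising
   steps it is bounded in L^r, so the local Sobolev estimate bounds its
   W^(alpha,r) norm on finitely many pieces covering [Omega]. It remains to
   bound a Sobolev norm on [Omega] by the norms on the pieces
   ([Wnorm_cover_le]), which is done chart by chart
   ([sobolev_norm_cover_le]):
   - local weak derivatives need not be glued: [w] has weak derivatives on the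
     whole chart images because its W^(alpha,s) norm is finite, and having
     weak derivatives does not depend on the exponent;
   - L^r norms of these derivatives are controlled by those on the pieces;
   - the Slobodeckij double integral is not local, but two points at distance
     less than some [delta] lie in a common piece (Lebesgue number, and
     uniform continuity of the inverse chart on a compact set), while for the
     other pairs the kernel is at most [delta^-(n + sigma r)], so that their
     contribution is controlled by the L^r norm and the finite volume of the
     chart image ([slobodeckij_cover_le]).

   Estimates are stated in the form: if the given norms are at most a real
   number [M], then the desired norm is at most [C * M]. Constants then compose
   without any computation with infinite values. *)

(** * Norms in L^r *)

Section Lr_norm_theory.
Context (R : realType) (d : measure_display) (T : measurableType d).
Variables (mu : {measure set T -> \bar R}) (p : nat).
Implicit Types (U : set T) (u : T -> 'rV[R[i]]_p).

Lemma cnorm_ge0 (z : 'rV[R[i]]_p) : 0 <= cnorm z.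
Proof. exact: sqrtr_ge0. Qed.

(** The factor 2 replaces the triangle inequality, which would need
   Cauchy-Schwarz: here the squares of the coordinates are enough. *)
Lemma cnormB_le (a b : 'rV[R[i]]_p) :
  cnorm (a - b) <= 2 * Num.max (cnorm a) (cnorm b).
Proof.
have S0 (z : 'rV[R[i]]_p) :
    0 <= \sum_(j < p) (complex.Re (z 0 j) ^+ 2 + complex.Im (z 0 j) ^+ 2).
  by apply: sumr_ge0 => j _; rewrite addr_ge0 ?sqr_ge0.
have m0 : 0 <= Num.max (cnorm a) (cnorm b) by rewrite le_max cnorm_ge0.
have sqr_cnorm (z : 'rV[R[i]]_p) : cnorm z ^+ 2 =
    \sum_(j < p) (complex.Re (z 0 j) ^+ 2 + complex.Im (z 0 j) ^+ 2).
  by rewrite sqr_sqrtr.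
rewrite -(ler_pXn2r (n := 2))// ?nnegrE ?cnorm_ge0 ?mulr_ge0//.
have H : cnorm (a - b) ^+ 2 <= 2 * cnorm a ^+ 2 + 2 * cnorm b ^+ 2.
  rewrite !sqr_cnorm !mulr_sumr -big_split /=; apply: ler_sum => j _.
  rewrite !mxE; case: (a 0 j) (b 0 j) => [x y] [x' y'] /=.
  rewrite -subr_ge0.
  suff -> : 2 * (x ^+ 2 + y ^+ 2) + 2 * (x' ^+ 2 + y' ^+ 2) -
    ((x - x') ^+ 2 + (y - y') ^+ 2) = (x + x') ^+ 2 + (y + y') ^+ 2.
    by rewrite addr_ge0 ?sqr_ge0.
  by ring.
apply: (le_trans H).
have Ha : cnorm a ^+ 2 <= Num.max (cnorm a) (cnorm b) ^+ 2.
  by rewrite ler_pXn2r ?nnegrE ?cnorm_ge0// le_max lexx.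
have Hb : cnorm b ^+ 2 <= Num.max (cnorm a) (cnorm b) ^+ 2.
  by rewrite ler_pXn2r ?nnegrE ?cnorm_ge0// le_max lexx orbT.
rewrite exprMn; move: Ha Hb.
set x := cnorm a ^+ 2; set y := cnorm b ^+ 2; set z := _ ^+ 2 => Ha Hb.
by lra.
Qed.

Lemma cnormB_powR_le (r : R) (a b : 'rV[R[i]]_p) : 0 <= r ->
  cnorm (a - b) `^ r <= 2 `^ r * (cnorm a `^ r + cnorm b `^ r).
Proof.
move=> r0; have m0 : 0 <= Num.max (cnorm a) (cnorm b).
  by rewrite le_max cnorm_ge0.
apply: (@le_trans _ _ ((2 * Num.max (cnorm a) (cnorm b)) `^ r)).
  by apply: ge0_ler_powR; rewrite ?nnegrE ?cnorm_ge0 ?mulr_ge0// cnormB_le.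
rewrite powRM// ler_wpM2l ?powR_ge0//.
by rewrite /Num.max; case: ifP => _; rewrite ?lerDl ?lerDr powR_ge0.
Qed.

Lemma cmeasurable_sub U V u : measurable U -> V `<=` U ->
  cmeasurable U u -> cmeasurable V u.
Proof.
move=> mU VU mu_ j; have [mre mim] := mu_ j.
by split; [exact: measurable_funS mre|exact: measurable_funS mim].
Qed.

Lemma cmeasurableB U u v : cmeasurable U u -> cmeasurable U v ->
  cmeasurable U (fun x => u x - v x).
Proof.
move=> hu hv j; have [ure uim] := hu j; have [vre vim] := hv j.
split.
  rewrite (_ : (fun x => _) =
    (fun x => complex.Re (u x 0 j) - complex.Re (v x 0 j))).
    exact: measurable_funB.
  by apply/funext => x; rewrite !mxE; case: (u x 0 j) (v x 0 j) => ? ? [].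
rewrite (_ : (fun x => _) =
  (fun x => complex.Im (u x 0 j) - complex.Im (v x 0 j))).
  exact: measurable_funB.
by apply/funext => x; rewrite !mxE; case: (u x 0 j) (v x 0 j) => ? ? [].
Qed.

Lemma measurable_cnorm U u : cmeasurable U u ->
  measurable_fun U (fun x => cnorm (u x)).
Proof.
move=> hu; rewrite /cnorm.
apply: (@measurableT_comp _ _ _ _ _ _ (@Num.sqrt R)).
  by apply: continuous_measurable_fun; exact: sqrt_continuous.
apply: measurable_sum => j; have [ure uim] := hu j.
by apply: measurable_funD; apply: measurable_funX.
Qed.

Lemma measurable_cnorm_powR U u (r : R) : cmeasurable U u ->
  measurable_fun U (fun x => (cnorm (u x) `^ r)%:E).
Proof.
move=> hu; apply/measurable_EFinP.
apply: (@measurableT_comp _ _ _ _ _ _ (@powR R ^~ r)) => //.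
exact: measurable_cnorm.
Qed.

Lemma Lr_normE U (r : R) u : r != 0 ->
  Lr_norm mu U r u = ((\int[mu]_(x in U) (cnorm (u x) `^ r)%:E) `^ r^-1)%E.
Proof.
move=> r0; rewrite /Lr_norm unlock; congr (_ `^ _)%E.
rewrite [RHS]integral_mkcond; apply: eq_integral => x _.
rewrite !patchE; case: ifPn => _ /=; first by rewrite ger0_norm ?cnorm_ge0.
by rewrite normr0 powR0.
Qed.

Lemma poweRV_leP (I : \bar R) (r M : R) : 0 < r -> 0 <= M -> (0 <= I)%E ->
  (I `^ r^-1 <= M%:E)%E <-> (I <= (M `^ r)%:E)%E.
Proof.
move=> r0 M0 I0.
have mon (s : R) (a b : \bar R) : 0 < s -> (0 <= a)%E -> (a <= b)%E ->
    (a `^ s <= b `^ s)%E.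
  move=> s0 a0 ab; apply: gt0_ler_poweR => //; rewrite ?ltW//.
    by rewrite in_itv/= a0 leey.
  by rewrite in_itv/= (le_trans a0 ab) leey.
split=> H.
  have := mon r _ _ r0 (poweR_ge0 _ _) H.
  by rewrite -poweRrM mulVf ?gt_eqF// poweRe1.
have := mon r^-1 _ _ _ I0 H; rewrite invr_gt0 => /(_ r0).
by rewrite poweR_EFin -powRrM mulfV ?gt_eqF// powRr1.
Qed.

Lemma Lr_norm_leP U (r M : R) u : 0 < r -> 0 <= M ->
  (Lr_norm mu U r u <= M%:E)%E <->
  (\int[mu]_(x in U) (cnorm (u x) `^ r)%:E <= (M `^ r)%:E)%E.
Proof.
move=> r0 M0; rewrite Lr_normE ?gt_eqF//; apply: poweRV_leP => //.
by apply: integral_ge0 => x _; rewrite lee_fin powR_ge0.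
Qed.

Lemma Lr_norm_ge0 U (r : R) u : (0 <= Lr_norm mu U r u)%E.
Proof. exact: Lnorm_ge0. Qed.

Lemma Lr_norm_sub U V (r : R) u : measurable U -> measurable V -> V `<=` U ->
  0 < r -> cmeasurable U u -> (Lr_norm mu V r u <= Lr_norm mu U r u)%E.
Proof.
move=> mU mV VU r0 hu; rewrite !Lr_normE ?gt_eqF//.
have ge0 (W : set T) : (0 <= \int[mu]_(x in W) (cnorm (u x) `^ r)%:E)%E.
  by apply: integral_ge0 => x _; rewrite lee_fin powR_ge0.
apply: gt0_ler_poweR; rewrite ?in_itv/= ?ge0 ?leey ?invr_ge0 ?(ltW r0)//.
apply: ge0_subset_integral => //; first exact: measurable_cnorm_powR.
by move=> x _; rewrite lee_fin powR_ge0.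
Qed.

(** The restriction of [f] to [U] is at most the sum of its restrictions to the
   pieces, since every point of [U] is in some piece. *)
Lemma ge0_integral_cover_le (k : nat) (B : 'I_k -> set T) U (f : T -> \bar R) :
  measurable U -> (forall j, measurable (B j)) -> (forall j, B j `<=` U) ->
  (forall x, U x -> exists j, B j x) ->
  (forall x, (0 <= f x)%E) -> measurable_fun U f ->
  (\int[mu]_(x in U) f x <= \sum_(j < k) \int[mu]_(x in B j) f x)%E.
Proof.
move=> mU mB BU cov f0 mf.
under eq_bigr do rewrite integral_mkcond.
have r0 j x : (0 <= (f \_ (B j)) x)%E by rewrite patchE; case: ifP.
have mr j : measurable_fun setT (f \_ (B j)).
  by apply: (measurable_restrictT f (mB j)).1; exact: (measurable_funS mU (BU j) mf).
rewrite -ge0_integral_sum// integral_mkcond.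
apply: ge0_le_integral => //.
- by move=> x _; rewrite patchE; case: ifP.
- exact: (measurable_restrictT f mU).1.
- exact: emeasurable_sum.
move=> x _; rewrite [leLHS]patchE; case: ifPn => [|_]; last exact: sume_ge0.
rewrite inE => /cov[j Bjx]; rewrite (bigD1 j)//= {1}patchE mem_set//.
by rewrite leeDl// sume_ge0.
Qed.

Lemma Lr_norm_cover_le (k : nat) (B : 'I_k -> set T) U (r M : R) u :
  measurable U -> (forall j, measurable (B j)) -> (forall j, B j `<=` U) ->
  (forall x, U x -> exists j, B j x) -> 0 < r -> 0 <= M -> cmeasurable U u ->
  (forall j, Lr_norm mu (B j) r u <= M%:E)%E ->
  (Lr_norm mu U r u <= (k%:R `^ r^-1 * M)%:E)%E.
Proof.
move=> mU mB BU cov r0 M0 hu hM.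
apply/Lr_norm_leP; rewrite ?mulr_ge0 ?powR_ge0//.
rewrite powRM ?powR_ge0// -powRrM mulVf ?gt_eqF// powRr1//.
apply: le_trans (ge0_integral_cover_le mU mB BU cov _ _) _.
- by move=> x; rewrite lee_fin powR_ge0.
- exact: measurable_cnorm_powR.
apply: (@le_trans _ _ (\sum_(j < k) (M `^ r)%:E)%E).
  by apply: lee_sum => j _; apply/Lr_norm_leP.
by rewrite sumEFin sumr_const card_ord lee_fin mulr_natl.
Qed.

(** If [M > 0] bounds the L^r norm, the pointwise inequality
   [a^q <= M^q + M^(q-r) a^r] (compare [a] with [M]) integrates to
   [M^q (mu U + 1)]. *)
Lemma Lr_norm_le_exponent U (q r : R) : measurable U -> (mu U < +oo)%E ->
  0 < q -> q <= r -> exists2 C : R, 0 < C & forall u (M : R), 0 <= M ->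
    cmeasurable U u -> (Lr_norm mu U r u <= M%:E)%E ->
    (Lr_norm mu U q u <= (C * M)%:E)%E.
Proof.
move=> mU muU q0 qr; have r0 : 0 < r by exact: lt_le_trans qr.
pose m := fine (mu U).
have mE : mu U = m%:E by rewrite fineK// ge0_fin_numE.
have m0 : 0 <= m by rewrite fine_ge0.
pose C := (m + 1) `^ q^-1.
have C0 : 0 < C by rewrite powR_gt0// ltr_wpDl// ltr01.
exists C => // u M M0 hu; wlog {M0} M0 : M / 0 < M.
  (* For [M = 0] the inequality holds with every [M' > 0] instead of [M]. *)
  move=> wl; move: M0; rewrite le_eqVlt => /predU1P[<-|M0]; last exact: wl.
  move=> H0; rewrite mulr0; apply/lee_addgt0Pr => e e0; rewrite add0e.
  have -> : e = C * (C^-1 * e) by rewrite mulVKf// gt_eqF.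
  apply: wl; first by rewrite mulr_gt0 ?invr_gt0.
  by apply: le_trans H0 _; rewrite lee_fin mulr_ge0 ?invr_ge0// ltW.
move/(Lr_norm_leP U u r0 (ltW M0)) => H.
apply/Lr_norm_leP; rewrite ?mulr_ge0 ?(ltW C0) ?(ltW M0)//.
rewrite powRM ?(ltW C0) ?(ltW M0)// -powRrM mulVf ?gt_eqF//.
rewrite powRr1; last by rewrite addr_ge0.
have ptw x : cnorm (u x) `^ q <= M `^ q + M `^ (q - r) * cnorm (u x) `^ r.
  have [le|lt] := leP (cnorm (u x)) M.
    apply: le_trans (_ : M `^ q <= _); last first.
      by rewrite lerDl mulr_ge0 ?powR_ge0.
    by apply: ge0_ler_powR; rewrite ?nnegrE ?cnorm_ge0 ?(ltW q0) ?(ltW M0).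
  apply: le_trans (_ : M `^ (q - r) * cnorm (u x) `^ r <= _); last first.
    by rewrite lerDr powR_ge0.
  have n0 : 0 < cnorm (u x) by exact: lt_trans lt.
  rewrite -[X in X <= _](_ : cnorm (u x) `^ (q - r) * cnorm (u x) `^ r = _);
    last first.
    by rewrite -powRD ?subrK// (gt_eqF n0) implybT.
  rewrite ler_wpM2r ?powR_ge0// -[q - r]opprB !powRN lef_pV2 ?posrE ?powR_gt0//.
  by apply: ge0_ler_powR; rewrite ?nnegrE ?subr_ge0// ltW.
have mr : measurable_fun U (fun x => ((M `^ (q - r))%:E * (cnorm (u x) `^ r)%:E)%E).
  by apply: measurable_funeM; exact: measurable_cnorm_powR.
apply: (@le_trans _ _ (\int[mu]_(x in U) ((M `^ q)%:E +
    (M `^ (q - r))%:E * (cnorm (u x) `^ r)%:E))%E).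
  apply: ge0_le_integral => //.
  - by move=> x _; rewrite lee_fin powR_ge0.
  - exact: measurable_cnorm_powR.
  - exact: emeasurable_funD.
  - by move=> x _; rewrite -EFinM -EFinD lee_fin.
have f0 x : U x -> (0 <= (cnorm (u x) `^ r)%:E)%E by rewrite lee_fin powR_ge0.
rewrite ge0_integralD//; last 2 first.
- by move=> x _; rewrite lee_fin powR_ge0.
- by move=> x _; rewrite mule_ge0// lee_fin powR_ge0.
rewrite integral_cst// mE ge0_integralZl// ?lee_fin ?powR_ge0//;
  last exact: measurable_cnorm_powR.
apply: (@le_trans _ _ ((M `^ q)%:E * m%:E + (M `^ (q - r))%:E * (M `^ r)%:E)%E).
  by apply: leeD2l; apply: lee_wpmul2l => //; rewrite lee_fin powR_ge0.
rewrite -!EFinM -EFinD lee_fin -powRD ?(gt_eqF M0) ?implybT// subrK.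
by rewrite mulrDl mul1r mulrC.
Qed.

End Lr_norm_theory.

(** * Lebesgue numbers of coverings by balls *)

Section Covering.
Context (R : realType).

Lemma metric_ball_open (X : metricType R) (x : X) (e : R) : open (ball x e).
Proof.
rewrite openE => y; rewrite ballEmdist /= => xy.
apply/nbhs_ballP; exists (e - mdist x y); first by rewrite /= subr_gt0.
move=> z; rewrite !ballEmdist /= ltrBrDl => yz.
exact: le_lt_trans (metric_triangle x y z) yz.
Qed.

(** Finitely many balls of a quarter of the given radius cover [A]; [lambda] is
   the least of these quarters (and 1), so a ball of radius [lambda] around
   a point of a quarter ball stays within the half-radius ball. *)
Lemma compact_lebesgue_number (X : pseudoMetricType R) (A : set X)
    (rho : X -> R) :
  compact A -> A !=set0 -> (forall x, A x -> 0 < rho x) ->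
  exists k (c : 'I_k -> X) (lambda : R), [/\ 0 < lambda, forall j, A (c j) &
    forall a, A a -> exists j, ball a lambda `<=` ball (c j) (rho (c j) / 2)].
Proof.
move=> cA [x0 Ax0] rho0.
(* The covering form of compactness needs a base point; any point of [A] does. *)
pose PX : ptopologicalType := HB.pack X (isPointed.Build X x0).
have : @cover_compact PX A by rewrite -compact_cover.
move=> /(_ X A (fun x => interior (ball x (rho x / 4)))) [].
- by move=> x _; exact: open_interior.
- by move=> x Ax; exists x => //; apply: nbhsx_ballx; rewrite divr_gt0 ?rho0.
move=> F' F'A Fcov; pose F : seq X := finmap.enum_fset F'.
have FA x : x \in F -> A x by move=> /F'A; rewrite inE.
pose c (j : 'I_(size F)) := nth x0 F j.
have Ac j : A (c j) by apply: FA; exact: mem_nth.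
pose lambda : R := \big[Order.min/1]_(j < size F) (rho (c j) / 4).
exists (size F), c, lambda; split => //.
- apply: (big_ind (fun z => 0 < z)) => // [y z y0 z0|j _].
    by rewrite lt_min y0.
  by rewrite divr_gt0 ?rho0.
move=> a /Fcov[x /= Fx /interior_subset xa].
have ltx : (index x F < size F)%N by rewrite index_mem.
exists (Ordinal ltx) => b ab.
have cE : c (Ordinal ltx) = x by rewrite /c nth_index.
rewrite cE.
have -> : rho x / 2 = rho x / 4 + rho x / 4 by field.
apply: ball_triangle xa _; apply: le_ball ab.
by rewrite /lambda -{1}cE; exact: bigmin_le_cond.
Qed.

End Covering.

(** * From local estimates to estimates on the whole domain *)

Section Local_to_global.
Context (R : realType) (X : completeMetricType R).
Variables (mu : {measure set (borel X) -> \bar R}) (p : nat).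
Variables (D : operator mu p) (Omega : set X).
Hypotheses (Omega0 : Omega !=set0) (oOmega : open Omega).
Hypotheses (cOmega : compact (closure Omega)) (fOmega : (mu Omega < +oo)%E).
Implicit Types (u f : X -> 'rV[R[i]]_p).

Lemma open_measurable_borel (U : set X) :
  open U -> measurable (U : set (borel X)).
Proof. by move=> oU; exact: sub_sigma_algebra. Qed.

Lemma solves_restrict (B : set X) u f : open B -> B `<=` Omega ->
  solves D Omega u f -> solves D B u f.
Proof.
move=> oB BO [domu uf]; have [domB eqB] := op_restrict oOmega oB BO domu.
split=> //; rewrite /ae_eq_on in uf eqB *; apply: filterS2 uf eqB => x H1 H2 Bx.
by rewrite H2// H1//; exact: BO.
Qed.

(** The balls are traces on [Omega], so the half-radius ones still cover
   [Omega] and no smaller domain appears; finitely many centres give a common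
   constant. The Lebesgue number [lambda] serves the nonlocal part of Sobolev
   norms. *)
Lemma uniform_local_estimate (N : set X -> (X -> 'rV[R[i]]_p) -> \bar R)
    (r : R) : 0 < r ->
  (forall x, closure Omega x -> exists2 rho : R, 0 < rho &
     local_estimate D N (rball Omega x rho) (rball Omega x (rho / 2)) r) ->
  exists k (B : 'I_k -> set X) (lambda C : R),
    [/\ 0 < lambda, 0 < C, forall j, open (B j) /\ B j `<=` Omega,
      forall a, Omega a -> exists j, ball a lambda `&` Omega `<=` B j &
      forall j u f (M : R), 0 <= M -> solves D Omega u f ->
        cmeasurable (Omega : set (borel X)) u ->
        cmeasurable (Omega : set (borel X)) f ->
        (Lr_norm mu Omega r u <= M%:E)%E -> (Lr_norm mu Omega r f <= M%:E)%E ->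
        (N (B j) u <= (C * M)%:E)%E].
Proof.
move=> r0 loc.
pose P x (y : R * R) := closure Omega x -> [/\ 0 < y.1, 0 < y.2 &
  forall u f, Lr_space mu (rball Omega x y.1) r u ->
    solves D (rball Omega x y.1) u f ->
    Lr_space mu (rball Omega x y.1) r f ->
    (N (rball Omega x (y.1 / 2)) u <= y.2%:E *
     (Lr_norm mu (rball Omega x y.1) r f +
      Lr_norm mu (rball Omega x y.1) r u))%E].
have /boolp.choice[g Pg] : forall x, exists y, P x y.
  move=> x; have [Ox|nOx] := pselect (closure Omega x).
    by have [rho rho0 [c c0 H]] := loc _ Ox; exists (rho, c).
  by exists (0, 0).
have cl0 : closure Omega !=set0.
  by have [x Ox] := Omega0; exists x; exact: subset_closure.
have [//|k [c [lambda [lambda0 cO cov]]]] :=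
  compact_lebesgue_number (rho := fun x => (g x).1) cOmega cl0.
  by move=> x /Pg[].
have gpos j : 0 < (g (c j)).2 by have /Pg[] := cO j.
pose C := 1 + \sum_(j < k) 2 * (g (c j)).2.
have C0 : 0 < C by rewrite ltr_wpDr// sumr_ge0// => j _; rewrite mulr_ge0// ltW.
have orb x e : open (rball Omega x e) by apply: openI => //; exact: metric_ball_open.
exists k, (fun j => rball Omega (c j) ((g (c j)).1 / 2)), lambda, C; split=> //.
- by move=> j; split=> // x [].
- move=> a Oa; have [j Hj] := cov _ (subset_closure Oa).
  by exists j => b [ab Ob]; split=> //; exact: Hj.
move=> j u f M M0 sol mu_ mf uM fM.
have /Pg[_ c0 H] := cO j; set B := rball Omega (c j) (g (c j)).1 in H.
have BO : B `<=` Omega by move=> x [].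
have oB : open B by exact: orb.
have mB := open_measurable_borel oB; have mO := open_measurable_borel oOmega.
have sub (v : X -> 'rV[R[i]]_p) : cmeasurable (Omega : set (borel X)) v ->
    (Lr_norm mu Omega r v <= M%:E)%E ->
    Lr_space mu B r v /\ (Lr_norm mu B r v <= M%:E)%E.
  move=> mv vM; have vB : (Lr_norm mu B r v <= M%:E)%E.
    exact: le_trans (Lr_norm_sub mu mO mB BO r0 mv) vM.
  split=> //; split; first exact: cmeasurable_sub mv.
  exact: le_lt_trans vB (ltry _).
have [su uB] := sub _ mu_ uM; have [sf fB] := sub _ mf fM.
apply: le_trans (H _ _ su (solves_restrict oB BO sol) sf) _.
apply: (@le_trans _ _ ((g (c j)).2%:E * (M%:E + M%:E))%E).
  by apply: lee_wpmul2l; [rewrite lee_fin ltW|exact: leeD].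
rewrite -EFinD -EFinM lee_fin -mulr2n -mulr_natl mulrA ler_wpM2r// mulrC.
(* [C] dominates [2 c_j]: the two norms on the right are each at most [M]. *)
rewrite /C (bigD1 j)//= addrCA lerDl addr_ge0// sumr_ge0// => i _.
by rewrite mulr_ge0// ltW.
Qed.

Section Bootstrap.
Variables (tau s r : R).
Hypotheses (tau0 : 0 < tau) (s1 : 1 < s) (sr : s <= r) (rtau : 0 < r^-1 - tau).
Hypothesis lir : local_increasing_regularity D Omega tau s.

(** [M] bounds both the L^s norm of [u] and the L^r norm of [Du]: this is the
   invariant of the raising steps. *)
Definition controls_norm (q : R) : Prop :=
  exists2 C : R, 0 < C & forall u f (M : R), 0 <= M -> solves D Omega u f ->
    cmeasurable (Omega : set (borel X)) u ->
    cmeasurable (Omega : set (borel X)) f ->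
    (Lr_norm mu Omega s u <= M%:E)%E -> (Lr_norm mu Omega r f <= M%:E)%E ->
    (Lr_norm mu Omega q u <= (C * M)%:E)%E.

Lemma controls_norm_init : controls_norm s.
Proof. by exists 1 => // u f M _ _ _ _; rewrite mul1r. Qed.

Lemma controls_norm_le (q q' : R) : 0 < q' -> q' <= q ->
  controls_norm q -> controls_norm q'.
Proof.
move=> q0 qq [C C0 H].
have mO := open_measurable_borel oOmega.
have [C' C'0 H'] := Lr_norm_le_exponent p mO fOmega q0 qq.
exists (C' * C); first exact: mulr_gt0.
move=> u f M M0 sol mu_ mf us fr; rewrite -mulrA; apply: H' => //.
  by rewrite mulr_ge0// ltW.
exact: H fr.
Qed.

(** One raising step: as [q <= r], the function [f = Du] is also controlled in
   L^q, so that the local estimate at exponent [q] applies. *)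
Lemma controls_norm_step (q : R) : s <= q -> q <= r ->
  controls_norm q -> controls_norm (q^-1 - tau)^-1.
Proof.
move=> sq qr [C C0 H].
have q0 : 0 < q by apply: lt_le_trans sq; exact: lt_trans s1.
have mO := open_measurable_borel oOmega.
have [C1 C10 H1] := Lr_norm_le_exponent p mO fOmega q0 qr.
have qtau : 0 < q^-1 - tau.
  apply: lt_le_trans rtau _; rewrite lerD2r lef_pV2// posrE//.
  exact: lt_le_trans qr.
have [x Ox|k [B [lambda [C2 [lambda0 C20 oB cov est]]]]] :=
    @uniform_local_estimate (fun B1 => Lr_norm mu B1 (q^-1 - tau)^-1) q q0.
  by have [rho rho0 Hrho] := lir Ox; exists rho => //; exact: Hrho.
exists ((k%:R `^ ((q^-1 - tau)^-1)^-1 + 1) * (C2 * (C + C1))).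
  by rewrite !mulr_gt0// ?addr_gt0// ltr_wpDl// powR_ge0.
move=> u f M M0 sol mu_ mf us fr.
pose M' := (C + C1) * M.
have M'0 : 0 <= M' by rewrite mulr_ge0// addr_ge0// ltW.
have uM' : (Lr_norm mu Omega q u <= M'%:E)%E.
  apply: le_trans (H _ _ _ M0 sol mu_ mf us fr) _.
  by rewrite lee_fin ler_wpM2r// lerDl ltW.
have fM' : (Lr_norm mu Omega q f <= M'%:E)%E.
  apply: le_trans (H1 _ _ M0 mf fr) _.
  by rewrite lee_fin ler_wpM2r// lerDr ltW.
have CM'0 : 0 <= C2 * M' by rewrite mulr_ge0// ltW.
apply: (@le_trans _ _ (k%:R `^ ((q^-1 - tau)^-1)^-1 * (C2 * M'))%:E).
  apply: (@Lr_norm_cover_le R _ (borel X) mu p k B Omega) => //.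
  - by move=> j; apply: open_measurable_borel; exact: (oB j).1.
  - by move=> j; exact: (oB j).2.
  - move=> x Ox; have [j Hj] := cov _ Ox; exists j; apply: Hj; split=> //.
    exact: ballxx.
  - by rewrite invr_gt0.
  - by move=> j; exact: est fM'.
rewrite lee_fin -mulrA -mulrA ler_wpM2r//.
by rewrite lerDl.
Qed.

(** After [k] steps the exponent is the inverse of
   [e k = max (1/r) (1/s - k tau)]; the cap [1/r] keeps it at most [r], where
   the raising step applies, and is reached as soon as [k > 1/(s tau)]. *)
Lemma controls_norm_bootstrap :
  controls_norm r /\ controls_norm (r^-1 - tau)^-1.
Proof.
have s0 : 0 < s by exact: lt_trans s1.
have r0 : 0 < r by exact: lt_le_trans sr.
have rV : 0 < r^-1 by rewrite invr_gt0.
have rsV : r^-1 <= s^-1 by rewrite lef_pV2.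
pose e (k : nat) := Num.max r^-1 (s^-1 - k%:R * tau).
have ek0 k : 0 < e k by rewrite lt_max rV.
have er k : r^-1 <= e k by rewrite le_max lexx.
have es k : e k <= s^-1.
  by rewrite ge_max rsV/= gerBl mulr_ge0// ltW.
have step k : controls_norm (e k)^-1.
  elim: k => [|k IH].
    rewrite /e mul0r subr0 (max_idPr rsV) invrK; exact: controls_norm_init.
  have : controls_norm (((e k)^-1)^-1 - tau)^-1.
    apply: controls_norm_step => //.
      by rewrite -[s]invrK lef_pV2 ?posrE ?invr_gt0.
    by rewrite -[leRHS]invrK lef_pV2 ?posrE.
  rewrite invrK; apply: controls_norm_le; first by rewrite invr_gt0.
  have ektau : 0 < e k - tau by apply: lt_le_trans rtau _; rewrite lerD2r.
  rewrite lef_pV2 ?posrE// /e le_max.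
  have [le|lt] := leP (s^-1 - k%:R * tau) r^-1.
    by rewrite gerBl (ltW tau0).
  by apply/orP; right; rewrite -natr1 mulrDl mul1r opprD addrA.
have cr : controls_norm r.
  pose k := (Num.truncn (s^-1 / tau)).+1.
  suff <- : (e k)^-1 = r by exact: step.
  rewrite /e (max_idPl _) ?invrK// (le_trans _ (ltW rV))// subr_le0.
  rewrite -ler_pdivrMr// ltW//; exact: truncnS_gt.
split=> //; exact: controls_norm_step.
Qed.

(** [N] is the norm in which the solution operator is bounded: the L^s norm in
   the first half of the theorem, the W^(alpha,s) norm in the second. *)
Lemma resolvability_bootstrap (N : (X -> 'rV[R[i]]_p) -> \bar R)
    (K : set (X -> 'rV[R[i]]_p)) :
  (forall w, (Lr_norm mu Omega s w <= N w)%E) ->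
  global_resolvability D Omega N s K ->
  exists2 C : R, 0 < C & forall omega, Lr_space mu Omega r omega ->
    orthogonal_to mu Omega omega K ->
    exists w, [/\ solves D Omega w omega,
      cmeasurable (Omega : set (borel X)) w, (N w < +oo)%E,
      (Lr_norm mu Omega r w <= C%:E * Lr_norm mu Omega r omega)%E &
      (Lr_norm mu Omega (r^-1 - tau)^-1 w <= C%:E * Lr_norm mu Omega r omega)%E].
Proof.
move=> sN [cg cg0 glob].
have s0 : 0 < s by exact: lt_trans s1.
have mO := open_measurable_borel oOmega.
have [C1 C10 H1] := Lr_norm_le_exponent p mO fOmega s0 sr.
have [[Cr Cr0 Hr] [Ct Ct0 Ht]] := controls_norm_bootstrap.
have A0 : 0 < cg * C1 + 1 by rewrite addr_gt0// mulr_gt0.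
exists ((Cr + Ct) * (cg * C1 + 1)); first by rewrite mulr_gt0// addr_gt0.
move=> omega [momega fomega] perp.
pose M0 := fine (Lr_norm mu Omega r omega).
have M0E : Lr_norm mu Omega r omega = M0%:E.
  by rewrite fineK// ge0_fin_numE// Lr_norm_ge0.
have M00 : 0 <= M0 by rewrite fine_ge0// Lr_norm_ge0.
have omegas : (Lr_norm mu Omega s omega <= (C1 * M0)%:E)%E.
  by apply: H1 => //; rewrite M0E.
have [|w [[mw _] sol Nw]] := glob omega _ perp.
  by split=> //; exact: le_lt_trans omegas (ltry _).
have NwM : (N w <= (cg * (C1 * M0))%:E)%E.
  apply: le_trans Nw _; rewrite EFinM; apply: lee_wpmul2l => //.
  by rewrite lee_fin ltW.
pose M := (cg * C1 + 1) * M0.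
have M_0 : 0 <= M by rewrite mulr_ge0// ltW.
have ws : (Lr_norm mu Omega s w <= M%:E)%E.
  apply: le_trans (sN w) _; apply: le_trans NwM _.
  by rewrite lee_fin mulrA ler_wpM2r// lerDl.
have om : (Lr_norm mu Omega r omega <= M%:E)%E.
  by rewrite M0E lee_fin ler_peMl// lerDr mulr_ge0// ltW.
exists w; split=> //; first exact: le_lt_trans NwM (ltry _).
  apply: le_trans (Hr _ _ _ M_0 sol mw momega ws om) _.
  by rewrite M0E -EFinM lee_fin -mulrA -/M ler_wpM2r// lerDl ltW.
apply: le_trans (Ht _ _ _ M_0 sol mw momega ws om) _.
by rewrite M0E -EFinM lee_fin -mulrA -/M ler_wpM2r// lerDr ltW.
Qed.

End Bootstrap.
End Local_to_global.

(** * Double integrals over a covered set *)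

Section Iterated_integral_cover.
Context (R : realType) (d : measure_display) (T : measurableType d).
Variable mu : {measure set T -> \bar R}.
Local Open Scope ereal_scope.

(** Tonelli's theorem for the finite measure [mu] restricted to [B]. *)
Lemma iterated_integral_measurable (B : set T) (F : T * T -> \bar R) :
  measurable B -> mu B < +oo -> measurable_fun setT F -> (forall z, 0 <= F z) ->
  measurable_fun setT (fun x => \int[mu]_(y in B) F (x, y)).
Proof.
move=> mB fB mF F0.
pose m : {finite_measure set T -> \bar R} := mfrestr mB fB.
pose G := F \_ (setT `*` B).
have mG : measurable_fun setT G.
  apply: (measurable_restrictT F _).1; first exact: measurableX.
  exact: measurable_funS mF.
have := @measurable_fun_fubini_tonelli_F _ _ T T R m G mG.
have G0 z : 0 <= G z by rewrite /G patchE; case: ifP.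
move=> /(_ G0); congr measurable_fun; apply/funext => x.
rewrite /fubini_F -(eq_measure_integral mu (m1 := m)); last first.
  by move=> A mA AB; rewrite /m /= /mfrestr /mrestr setIidl.
rewrite [RHS]integral_mkcond; apply: eq_integral => y _.
rewrite /G !patchE; congr (if _ then _ else _).
by apply/idP/idP; rewrite !inE => // -[].
Qed.

(** Pairs in a common piece are counted by the sum over the pieces; for all the
   others [F] is at most [h x + h y], whose double integral over [O] is
   [2 mu(O)] times the integral of [h]. *)
Lemma iterated_integral_cover_le (k : nat) (B : 'I_k -> set T) (O : set T)
    (F : T * T -> \bar R) (h : T -> \bar R) :
  measurable O -> mu O < +oo -> (forall j, measurable (B j)) ->
  (forall j, B j `<=` O) -> measurable_fun setT F -> (forall z, 0 <= F z) ->
  measurable_fun O h -> (forall x, 0 <= h x) ->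
  (forall x y, O x -> O y -> (exists j, B j x /\ B j y) \/
                             F (x, y) <= h x + h y) ->
  \int[mu]_(x in O) \int[mu]_(y in O) F (x, y) <=
  \sum_(j < k) \int[mu]_(x in B j) \int[mu]_(y in B j) F (x, y) +
  (mu O * \int[mu]_(x in O) h x + mu O * \int[mu]_(x in O) h x).
Proof.
move=> mO fO mB BO mF F0 mh h0 near_or_far.
have fB j : mu (B j) < +oo.
  by apply: le_lt_trans fO; apply: le_measure; rewrite ?inE.
have mFx x : measurable_fun setT (fun y => F (x, y)).
  exact: measurableT_comp mF (measurable_fun_pair _ _).
pose I j x := \int[mu]_(y in B j) F (x, y).
have I0 j x : 0 <= I j x by apply: integral_ge0.
have mI j : measurable_fun setT (I j) by exact: iterated_integral_measurable.
pose J j := I j \_ (B j).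
have J0 j x : 0 <= J j x by rewrite /J patchE; case: ifP.
have mJ j : measurable_fun setT (J j).
  apply: (measurable_restrictT (I j) (mB j)).1; exact: measurable_funS (mI j).
pose H := \int[mu]_(x in O) h x.
have H0 : 0 <= H by exact: integral_ge0.
have inner x : O x -> \int[mu]_(y in O) F (x, y) <=
    \sum_(j < k) J j x + (mu O * h x + H).
  move=> Ox.
  pose P j y := if x \in B j then ((fun y => F (x, y)) \_ (B j)) y else 0.
  have P0 j y : 0 <= P j y by rewrite /P patchE; case: ifP => // _; case: ifP.
  have mP j : measurable_fun O (P j).
    rewrite /P; case: (x \in B j); last exact: measurable_cst.
    apply: measurable_funTS.
    apply: (measurable_restrictT _ (mB j)).1; exact: measurable_funS (mFx x).
  have -> : \sum_(j < k) J j x + (mu O * h x + H) =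
      \int[mu]_(y in O) (\sum_(j < k) P j y + (h x + h y)).
    have m1 : measurable_fun O (fun y => \sum_(j < k) P j y).
      exact: emeasurable_sum.
    have m2 : measurable_fun O (fun y => h x + h y) by exact: emeasurable_funD.
    rewrite ge0_integralD//; last 2 first.
    - by move=> y _; exact: sume_ge0.
    - by move=> y _; exact: adde_ge0.
    rewrite ge0_integralD// integral_cst// (muleC (h x)) ge0_integral_sum//.
    congr (_ + _); apply: eq_bigr => j _; rewrite /J /P patchE.
    case: ifP => _; last by rewrite integral0.
    by rewrite /I -[in LHS](setIidr (BO j)) integral_mkcondr.
  apply: ge0_le_integral => //.
  - exact: measurable_funTS.
  - by apply: emeasurable_funD; [exact: emeasurable_sum|exact: emeasurable_funD].
  move=> y Oy; have [[j [Bx By]]|le] := near_or_far x y Ox Oy.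
    rewrite (bigD1 j)//= {1}/P (mem_set Bx) patchE (mem_set By) -addeA leeDl//.
    by rewrite !adde_ge0// sume_ge0.
  by apply: le_trans le _; rewrite leeDr// sume_ge0.
have mS : measurable_fun O (fun x => \sum_(j < k) J j x).
  by apply: emeasurable_sum => j; exact: measurable_funTS.
have mc : measurable_fun O (fun x => mu O * h x) by exact: emeasurable_funM.
apply: (@le_trans _ _
    (\int[mu]_(x in O) (\sum_(j < k) J j x + (mu O * h x + H)))).
  apply: ge0_le_integral => //.
  - by move=> x _; exact: integral_ge0.
  - exact: measurable_funTS (iterated_integral_measurable mO fO mF F0).
  - by apply: emeasurable_funD => //; exact: emeasurable_funD.
rewrite ge0_integralD//; last 3 first.
- by move=> x _; exact: sume_ge0.
- by move=> x _; rewrite adde_ge0// mule_ge0.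
- exact: emeasurable_funD.
rewrite ge0_integralD//; last by move=> x _; rewrite mule_ge0.
rewrite integral_cst// ge0_integralZl// (muleC H) ge0_integral_sum//; last first.
  by move=> j; exact: measurable_funTS.
rewrite leeD2r// lee_sum// => j _.
by rewrite /J -integral_mkcondr setIidr.
Qed.

End Iterated_integral_cover.

(** * Slobodeckij seminorms *)

Section Euclidean.
Context (R : realType) (n : nat).
Local Notation E := (borel 'rV[R]_n).

Lemma continuous_borel_measurable (X : ptopologicalType) (f : X -> R) :
  continuous f -> @measurable_fun _ _ (borel X) R setT f.
Proof.
move=> cf; apply: (measurability _ (RGenOInfty.measurableE R)) => //.
move=> _ [_ [a ->] <-]; rewrite setTI; apply: sub_sigma_algebra.
by move/continuousP : cf; apply; exact: interval_open.
Qed.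

(** On the product of the two Borel sigma-algebras continuity of the distance
   is not enough; the norm is a maximum of finitely many coordinates. *)
Lemma measurable_norm_sub :
  measurable_fun setT (fun z : E * E => `|(z.1 : 'rV[R]_n) - (z.2 : 'rV[R]_n)|).
Proof.
have -> : (fun z : E * E => `|(z.1 : 'rV[R]_n) - (z.2 : 'rV[R]_n)|) =
    (fun z => \big[Num.max/0]_(ij : 'I_1 * 'I_n)
       `|(z.1 : 'rV[R]_n) ij.1 ij.2 - (z.2 : 'rV[R]_n) ij.1 ij.2|).
  apply/funext => z; rewrite /Num.norm /= mx_normrE.
  by apply: eq_bigr => ij _; rewrite !mxE.
have mcoord ij : @measurable_fun _ _ E R setT (fun x : 'rV[R]_n => x ij.1 ij.2).
  by apply: continuous_borel_measurable; exact: coord_continuous.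
elim: (index_enum _) => [|ij l IH].
  under eq_fun do rewrite big_nil; exact: measurable_cst.
under eq_fun do rewrite big_cons.
apply: measurable_maxr => //; apply: measurableT_comp => //.
apply: measurable_funB.
  exact: measurableT_comp (mcoord ij) measurable_fst.
exact: measurableT_comp (mcoord ij) measurable_snd.
Qed.

Section Slobodeckij.
Variables (vol : {measure set E -> \bar R}) (p : nat).
Implicit Types (O : set 'rV[R]_n) (g : 'rV[R]_n -> 'rV[R[i]]_p).

Let quotient (e r : R) g (z : E * E) : \bar R :=
  (cnorm (g z.1 - g z.2) `^ r /
   `|(z.1 : 'rV[R]_n) - (z.2 : 'rV[R]_n)| `^ e)%:E.

Let quotient_ge0 (e r : R) g z : (0 <= quotient e r g z)%E.
Proof. by rewrite lee_fin divr_ge0 ?powR_ge0. Qed.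

Let measurable_quotient (e r : R) g : @cmeasurable R _ E p setT g ->
  measurable_fun setT (quotient e r g).
Proof.
move=> mg; apply/measurable_EFinP; apply: measurable_funM.
  apply: (@measurableT_comp _ _ _ _ _ _ (@powR R ^~ r)) => //.
  apply: measurable_cnorm; apply: cmeasurableB => j; have [mre mim] := mg j.
    by split; [exact: measurableT_comp mre measurable_fst|
               exact: measurableT_comp mim measurable_fst].
  by split; [exact: measurableT_comp mre measurable_snd|
             exact: measurableT_comp mim measurable_snd].
under eq_fun do rewrite -powRN.
apply: (@measurableT_comp _ _ _ _ _ _ (@powR R ^~ (- e))) => //.
exact: measurable_norm_sub.
Qed.

Lemma slobodeckij_ge0 O (sigma r : R) g : (0 <= slobodeckij vol O sigma r g)%E.
Proof. exact: poweR_ge0. Qed.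

(** Pairs at distance at least [delta] contribute at most
   [K (|g x|^r + |g y|^r)] with [K = 2^r / delta^e], where [e = n + sigma r]. *)
Lemma slobodeckij_cover_le (k : nat) (B : 'I_k -> set 'rV[R]_n) O
    (delta sigma r : R) :
  measurable (O : set E) -> (vol O < +oo)%E ->
  (forall j, measurable (B j : set E)) -> (forall j, B j `<=` O) ->
  0 < delta -> (forall x y, O x -> O y -> `|x - y| < delta ->
    exists j, B j x /\ B j y) ->
  0 <= sigma -> 0 < r ->
  exists2 C : R, 0 < C & forall g (M : R), 0 <= M ->
    @cmeasurable R _ E p O g -> (Lr_norm vol O r g <= M%:E)%E ->
    (forall j, slobodeckij vol (B j) sigma r g <= M%:E)%E ->
    (slobodeckij vol O sigma r g <= (C * M)%:E)%E.
Proof.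
move=> mO fO mB BO delta0 close sigma0 r0.
pose e := n%:R + sigma * r.
have e0 : 0 <= e by rewrite addr_ge0// mulr_ge0// ltW.
pose v := fine (vol O).
have vE : vol O = v%:E by rewrite fineK// ge0_fin_numE.
have v0 : 0 <= v by rewrite fine_ge0.
pose K := 2 `^ r / delta `^ e.
have K0 : 0 <= K by rewrite divr_ge0 ?powR_ge0.
pose A := k%:R + (v * K + v * K).
have A0 : 0 <= A by rewrite !addr_ge0// mulr_ge0.
exists (A `^ r^-1 + 1); first by rewrite ltr_wpDl// powR_ge0.
move=> g M M0 mg gM sM.
(* Extension by 0 makes the kernel measurable on the whole product space. *)
pose g' (x : 'rV[R]_n) : 'rV[R[i]]_p := if x \in O then g x else 0.
have g'E x : O x -> g' x = g x by move=> Ox; rewrite /g' mem_set.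
have mg' : @cmeasurable R _ E p setT g'.
  move=> j; have [mre mim] := mg j; split.
    rewrite (_ : (fun x => _) = (fun x => complex.Re (g x 0 j)) \_ O).
      exact: (measurable_restrictT _ mO).1.
    by apply/funext => x; rewrite patchE /g'; case: ifP => // _; rewrite mxE.
  rewrite (_ : (fun x => _) = (fun x => complex.Im (g x 0 j)) \_ O).
    exact: (measurable_restrictT _ mO).1.
  by apply/funext => x; rewrite patchE /g'; case: ifP => // _; rewrite mxE.
have eqI U : U `<=` O ->
    (\int[vol]_(x in U) \int[vol]_(y in U)
      (cnorm (g x - g y) `^ r / `|x - y| `^ e)%:E =
     \int[vol]_(x in U) \int[vol]_(y in U) quotient e r g' (x, y))%E.
  move=> UO; apply: eq_integral => x; rewrite inE => Ux.
  apply: eq_integral => y; rewrite inE => Uy.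
  by rewrite /quotient /= !g'E//; exact: UO.
have leP U : U `<=` O -> forall N : R, 0 <= N ->
    (slobodeckij vol U sigma r g <= N%:E)%E <->
    (\int[vol]_(x in U) \int[vol]_(y in U) quotient e r g' (x, y) <=
     (N `^ r)%:E)%E.
  move=> UO N N0; have -> : slobodeckij vol U sigma r g =
      ((\int[vol]_(x in U) \int[vol]_(y in U) quotient e r g' (x, y)) `^ r^-1)%E.
    by rewrite -(eqI _ UO).
  apply: poweRV_leP => //.
  apply: integral_ge0 => x _; apply: integral_ge0 => y _; exact: quotient_ge0.
apply: (@le_trans _ _ (A `^ r^-1 * M)%:E); last first.
  by rewrite lee_fin ler_wpM2r// lerDl.
apply/leP => //; first by rewrite mulr_ge0// powR_ge0.
rewrite powRM ?powR_ge0// -powRrM mulVf ?gt_eqF// powRr1//.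
pose h x : \bar R := (K%:E * (cnorm (g x) `^ r)%:E)%E.
have h0 x : (0 <= h x)%E by rewrite mule_ge0// lee_fin ?powR_ge0.
have mh : @measurable_fun _ _ E _ O h.
  by apply: measurable_funeM; exact: measurable_cnorm_powR.
have hM : (\int[vol]_(x in O) h x <= (K * M `^ r)%:E)%E.
  rewrite ge0_integralZl//; last 2 first.
  - exact: measurable_cnorm_powR.
  - by move=> x _; rewrite lee_fin powR_ge0.
  rewrite [leRHS]EFinM; apply: lee_wpmul2l; first by rewrite lee_fin.
  exact/Lr_norm_leP.
have far x y : O x -> O y -> (exists j, B j x /\ B j y) \/
    (quotient e r g' (x, y) <= h x + h y)%E.
  move=> Ox Oy; have [xy|xy] := ltP `|x - y| delta; first by left; exact: close.
  right; rewrite /quotient /h /= !g'E// -!EFinM -EFinD lee_fin -mulrDr.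
  rewrite /K mulrAC; apply: ler_pM; rewrite ?invr_ge0 ?powR_ge0//.
    exact/cnormB_powR_le/ltW.
  rewrite lef_pV2 ?posrE ?powR_gt0//; last exact: lt_le_trans xy.
  by apply: ge0_ler_powR; rewrite ?nnegrE// ltW.
have := @iterated_integral_cover_le R _ E vol k B O (quotient e r g') h mO fO
  mB BO (@measurable_quotient e r g' mg') (@quotient_ge0 e r g') mh h0 far.
move=> /le_trans; apply.
rewrite vE /A mulrDl EFinD; apply: leeD.
  apply: (@le_trans _ _ (\sum_(j < k) (M `^ r)%:E)%E).
    by apply: lee_sum => j _; apply/leP.
  by rewrite sumEFin sumr_const card_ord lee_fin mulr_natl.
rewrite mulrDl EFinD -mulrA.
by apply: leeD; rewrite [leRHS]EFinM; apply: lee_wpmul2l; rewrite ?lee_fin.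
Qed.

End Slobodeckij.
End Euclidean.

(** * Weak derivatives and Sobolev norms on Euclidean sets *)

Lemma cintegral_support (R : realType) (d : measure_display)
    (T : measurableType d) (mu : {measure set T -> \bar R}) (U V : set T)
    (f : T -> R[i]) :
  V `<=` U -> (forall x, ~ V x -> f x = 0) ->
  cintegral mu U f = cintegral mu V f.
Proof.
move=> VU f0; rewrite /cintegral /Rintegral.
have E (h : R[i] -> R) : h 0 = 0 ->
    (\int[mu]_(x in U) (h (f x))%:E = \int[mu]_(x in V) (h (f x))%:E)%E.
  move=> h0; rewrite integral_mkcond [RHS]integral_mkcond.
  apply: eq_integral => x _; rewrite !patchE.
  have [Vx|nVx] := pselect (V x); first by rewrite !mem_set//; exact: VU.
  by rewrite f0// h0 !if_same.
by rewrite !E.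
Qed.

Section Weak_derivatives.
Context (R : realType) (n : nat).
Local Notation E := (borel 'rV[R]_n).
Variables (vol : {measure set E -> \bar R}) (p : nat).
Implicit Types (O : set 'rV[R]_n) (v g : 'rV[R]_n -> 'rV[R[i]]_p).

(** Off the closed set [C] the function vanishes in a neighbourhood, hence so
   does each difference quotient. *)
Lemma pderiv_support (W : normedModType R) (C : set 'rV[R]_n)
    (f : 'rV[R]_n -> W) (w : seq 'I_n) :
  closed C -> (forall x, ~ C x -> f x = 0) -> forall x, ~ C x -> pderiv w f x = 0.
Proof.
move=> cC f0; elim: w => [//|i w IH] x nCx /=.
rewrite (near_eq_derive (g := cst 0)) ?derive_cst//.
have : nbhs x (~` C) by apply: open_nbhs_nbhs; split=> //; exact: closed_openC.
by apply: filterS => y; exact: IH.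
Qed.

(** A test function on [O'] is one on [O], and the integrands in the definition
   vanish outside its support, so integrating over [O] or [O'] is the same. *)
Lemma weak_derivative_sub O O' (w : seq 'I_n) v g :
  measurable (O : set E) -> O' `<=` O ->
  weak_derivative vol O w v g -> weak_derivative vol O' w v g.
Proof.
move=> mO OO [[mv iv] [mg ig] ibp]; split.
- split; first exact: (cmeasurable_sub mO OO).
  by move=> C cC CO; apply: iv => //; exact: subset_trans OO.
- split; first exact: (cmeasurable_sub mO OO).
  by move=> C cC CO; apply: ig => //; exact: subset_trans OO.
move=> phi [sphi [C [cC CO phi0]]] j.
have clC : closed C by apply: compact_closed => //; exact: norm_hausdorff.
have tphi : test_function O phi.
  by split=> //; exists C; split=> //; exact: subset_trans OO.
have := ibp _ tphi j.
rewrite (@cintegral_support _ _ E vol O O')//; last first.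
  move=> x nOx; rewrite (pderiv_support w clC phi0); last by move/CO.
  by rewrite rmorph0 mulr0.
rewrite (@cintegral_support _ _ E vol O O')//.
move=> x nOx; rewrite phi0; last by move/CO.
by rewrite rmorph0 mulr0.
Qed.

Lemma weak_derivatives_sub O O' (k : nat) v G :
  measurable (O : set E) -> O' `<=` O ->
  weak_derivatives vol O k v G -> weak_derivatives vol O' k v G.
Proof. by move=> mO OO H w wk; apply: weak_derivative_sub mO OO (H w wk). Qed.

Lemma sobolev_sum_ge0 O (alpha r : R) (G : seq 'I_n -> 'rV[R]_n -> 'rV[R[i]]_p) :
  (0 <= sobolev_sum vol O alpha r G)%E.
Proof.
rewrite /sobolev_sum; apply: adde_ge0.
  by apply: sume_ge0 => m _; apply: sume_ge0 => w _; exact: Lr_norm_ge0.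
by case: ifP => // _; apply: sume_ge0 => w _; exact: slobodeckij_ge0.
Qed.

Lemma sobolev_norm_ge0 O (alpha r : R) v : (0 <= sobolev_norm vol O alpha r v)%E.
Proof.
rewrite /sobolev_norm; case: asboolP => // -[G HG].
by apply: le_trans (sobolev_sum_ge0 _ _ _ _) (ereal_sup_ubound _); exists G.
Qed.

(** The norm is a supremum over families [G] of weak derivatives on [O]. Each of
   them restricts to the pieces, where it competes in the local suprema, so the
   bound is proved for one [G] at a time. *)
Lemma sobolev_norm_cover_le (k : nat) (B : 'I_k -> set 'rV[R]_n) O
    (delta alpha r : R) :
  measurable (O : set E) -> (vol O < +oo)%E ->
  (forall j, measurable (B j : set E)) -> (forall j, B j `<=` O) ->
  0 < delta -> (forall x y, O x -> O y -> `|x - y| < delta ->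
    exists j, B j x /\ B j y) ->
  0 <= alpha -> 0 < r ->
  exists2 C : R, 0 < C & forall v (M : R), 0 <= M ->
    weak_derivatives vol O (Num.truncn alpha) v !=set0 ->
    (forall j, sobolev_norm vol (B j) alpha r v <= M%:E)%E ->
    (sobolev_norm vol O alpha r v <= (C * M)%:E)%E.
Proof.
move=> mO fO mB BO delta0 close alpha0 r0.
pose K := Num.truncn alpha.
have sigma0 : 0 <= alpha - K%:R by rewrite subr_ge0 truncn_le.
have [C2 C20 slob] := slobodeckij_cover_le p mO fO mB BO delta0 close sigma0 r0.
pose C1 : R := k%:R `^ r^-1 + 1.
have C10 : 0 < C1 by rewrite ltr_wpDl// powR_ge0.
pose L1 : R := \sum_(m < K.+1) \sum_(w : m.-tuple 'I_n) C1.
pose L2 : R := \sum_(w : K.-tuple 'I_n) (C2 * C1).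
have L10 : 0 <= L1.
  by apply: sumr_ge0 => m _; apply: sumr_ge0 => w _; exact: ltW.
have L20 : 0 <= L2 by apply: sumr_ge0 => w _; rewrite mulr_ge0// ltW.
exists (L1 + L2 + 1); first by rewrite ltr_wpDl// addr_ge0.
move=> v M M0 W0 locM.
have cov x : O x -> exists j, B j x.
  move=> Ox; have [|j []] := close _ _ Ox Ox; last by exists j.
  by rewrite subrr normr0.
rewrite /sobolev_norm asboolT//; apply: ge_ereal_sup => _ [G WG <-].
have sumM j : (sobolev_sum vol (B j) alpha r G <= M%:E)%E.
  apply: le_trans (locM j).
  have WBG : weak_derivatives vol (B j) K v G.
    exact: (weak_derivatives_sub mO (BO j) WG).
  rewrite /sobolev_norm asboolT; last by exists G.
  by apply: ereal_sup_ubound; exists G.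
have term_le (I : finType) (F : I -> \bar R) i : (forall i, 0 <= F i)%E ->
    (F i <= \sum_i F i)%E.
  by move=> F0; rewrite (bigD1 i)//= leeDl// sume_ge0.
have mG (w : seq 'I_n) : (size w <= K)%N -> @cmeasurable R _ E p O (G w).
  by move=> wK; have [_ [] ] := WG w wK.
have LrM (m : 'I_K.+1) (w : m.-tuple 'I_n) :
    (Lr_norm vol O r (G w) <= (C1 * M)%:E)%E.
  apply: (@le_trans _ _ (k%:R `^ r^-1 * M)%:E); last first.
    by rewrite lee_fin ler_wpM2r// lerDl.
  apply: (@Lr_norm_cover_le R _ E vol p k B O) => //.
    by apply: mG; rewrite size_tuple -ltnS.
  move=> j; apply: le_trans (sumM j); rewrite /sobolev_sum.
  apply: le_trans (leeDl _ _); last first.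
    by case: ifP => // _; apply: sume_ge0 => w' _; exact: slobodeckij_ge0.
  pose F (m : 'I_K.+1) := (\sum_(w : m.-tuple 'I_n) Lr_norm vol (B j) r (G w))%E.
  have F0 m' : (0 <= F m')%E by apply: sume_ge0 => w' _; exact: Lr_norm_ge0.
  apply: le_trans (term_le _ F m F0).
  by apply: term_le => w'; exact: Lr_norm_ge0.
rewrite /sobolev_sum -/K.
apply: (@le_trans _ _ ((L1 + L2) * M)%:E); last first.
  by rewrite lee_fin ler_wpM2r// lerDl.
rewrite mulrDl EFinD; apply: leeD.
  rewrite mulr_suml -sumEFin; apply: lee_sum => m _.
  by rewrite mulr_suml -sumEFin; apply: lee_sum => w _.
case: ifPn => aK; first by rewrite lee_fin mulr_ge0.
rewrite mulr_suml -sumEFin; apply: lee_sum => w _.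
rewrite -mulrA; apply: slob.
- by rewrite mulr_ge0// ltW.
- by apply: mG; rewrite size_tuple.
- exact: (LrM ord_max).
move=> j; apply: (@le_trans _ _ M%:E); last first.
  by rewrite lee_fin ler_peMl// lerDr powR_ge0.
apply: le_trans (sumM j); rewrite /sobolev_sum -/K (negbTE aK).
apply: le_trans (leeDr _ _); last first.
  by apply: sume_ge0 => m _; apply: sume_ge0 => w' _; exact: Lr_norm_ge0.
apply: (term_le _ (fun w : K.-tuple 'I_n =>
  slobodeckij vol (B j) (alpha - K%:R) r (G w))) => w'.
exact: slobodeckij_ge0.
Qed.

Lemma lebesgue_bounded_finite O : is_lebesgue vol -> measurable (O : set E) ->
  bounded_set O -> (vol O < +oo)%E.
Proof.
move=> leb mO [M0 [_ /(_ (M0 + 1))]]; rewrite ltrDl ltr01 => /(_ isT) HM.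
pose M : R := `|M0 + 1|.
pose a : 'rV[R]_n := const_mx (- M); pose b : 'rV[R]_n := const_mx M.
pose box := [set x : 'rV[R]_n | forall i, a 0 i <= x 0 i <= b 0 i].
have volbox : vol box = (\prod_(i < n) (b 0 i - a 0 i))%:E.
  apply: leb => i; rewrite !mxE.
  by apply: (@le_trans _ _ 0); rewrite ?oppr_le0 normr_ge0.
have mbox : measurable (box : set E).
  have cbox : compact box.
    have := @rV_compact R n (fun=> [set` `[- M, M]%R])
      (fun=> @segment_compact _ _ _).
    congr compact; apply/seteqP; split=> x Hx i; have := Hx i.
      by rewrite /= in_itv !mxE.
    by rewrite /= in_itv !mxE.
  have clbox : closed box by apply: compact_closed => //; exact: norm_hausdorff.
  rewrite -[box]setCK; apply: measurableC; apply: sub_sigma_algebra.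
  exact: closed_openC.
apply: (@le_lt_trans _ _ (vol box)); last by rewrite volbox ltry.
apply: le_measure; rewrite ?inE//.
move=> x Ox i; have := HM x Ox; rewrite /= => xM.
rewrite !mxE -ler_norml; apply: le_trans (ler_norm _).
apply: le_trans xM; rewrite [leRHS]/Num.norm /= mx_normrE.
exact: (le_bigmax _ (fun ij : 'I_1 * 'I_n => `|x ij.1 ij.2|) (0, i)).
Qed.

End Weak_derivatives.

(** * Charts and Sobolev norms on a manifold *)

Section Charts.
Context (R : realType) (X : completeMetricType R) (n : nat).
Implicit Types (c : chart R X n) (U V : set X).

Lemma chart_image_open c U : open U -> U `<=` chart_dom c -> open (c @` U).
Proof.
move=> oU Ud; have oI := @chart_img_open _ _ _ c.
have ci := @chart_inv_continuous _ _ _ c.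
rewrite continuous_open_subspace// in ci.
have := (continuous_inP (chart_inv c) oI).1 ci U oU.
congr open; apply/seteqP; split=> [y [[x dx <-]] /= |_ [x Ux <-]].
  by rewrite chart_mapK// => Ux; exists x.
split; first by exists x => //; exact: Ud.
by rewrite /= chart_mapK//; exact: Ud.
Qed.

Lemma chart_image_compact c V : compact V -> V `<=` chart_dom c ->
  compact (c @` V).
Proof.
move=> cV Vd; apply: continuous_compact => //.
exact: continuous_subspaceW Vd (@chart_map_continuous _ _ _ c).
Qed.

(** Heine's theorem for the inverse chart on the compact image of [V]. *)
Lemma chart_inv_uniform c V (lambda : R) : compact V -> V `<=` chart_dom c ->
  0 < lambda -> exists2 delta : R, 0 < delta &
    forall a b, V a -> V b -> `|c a - c b| < delta -> ball a lambda b.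
Proof.
move=> cV Vd lambda0; have [V0|/set0P V0] := eqVneq V set0.
  by exists 1 => // a b; rewrite V0.
have cI : compact (c @` V) by exact: chart_image_compact.
have I0 : c @` V !=set0 by have [x Vx] := V0; exists (c x), x.
have ci := @chart_inv_continuous _ _ _ c.
rewrite continuous_open_subspace in ci; last exact: (@chart_img_open _ _ _ c).
pose P (y : 'rV[R]_n) (e : R) := (c @` V) y -> 0 < e /\
  forall z, ball y e z -> ball (chart_inv c y) (lambda / 2) (chart_inv c z).
have /boolp.choice[e Pe] : forall y, exists e, P y e.
  move=> y; have [Iy|nIy] := pselect ((c @` V) y); last by exists 1.
  have /ci cy : y \in c @` chart_dom c.
    by rewrite inE; case: Iy => x Vx <-; exists x => //; exact: Vd.
  have /cy : nbhs (chart_inv c y) (ball (chart_inv c y) (lambda / 2)).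
    by apply: nbhsx_ballx; rewrite divr_gt0.
  by move=> /nbhs_ballP[e e0 He]; exists e => _; split.
have [//|k [y [delta [delta0 Iy cov]]]] :=
  compact_lebesgue_number (rho := e) cI I0.
  by move=> z /Pe[].
exists delta => // a b Va Vb ab.
have Ica : (c @` V) (c a) by exists a.
have [j Hj] := cov _ Ica.
have [ej0 Hej] := Pe _ (Iy j).
have le2 : e (y j) / 2 <= e (y j) by rewrite ler_pdivrMr// ler_peMr ?ler1n// ltW.
have /(le_ball le2)/Hej : ball (y j) (e (y j) / 2) (c a) by apply: Hj; exact: ballxx.
have /(le_ball le2)/Hej : ball (y j) (e (y j) / 2) (c b).
  by apply: Hj; rewrite -ball_normE.
rewrite !chart_mapK; [|exact: Vd|exact: Vd] => yb ya.
exact: ball_splitr ya yb.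
Qed.

End Charts.

Section Manifold_cover.
Context (R : realType) (X : completeMetricType R) (n m : nat).
Variables (mu : {measure set (borel X) -> \bar R}) (p : nat).
Variable vol : {measure set (borel 'rV[R]_n) -> \bar R}.
Variables (A : set (chart R X n)) (ch : 'I_m -> chart R X n) (V : 'I_m -> set X).
Variable Omega : set X.
Hypotheses (leb : is_lebesgue vol) (cover : chart_cover A Omega ch V).
Hypothesis oOmega : open Omega.

(** This condition does not mention the exponent: it can be obtained from the
   Sobolev norm at [s] and used for the norm at [r]. *)
Definition has_chart_derivatives (alpha : R) (u : X -> 'rV[R[i]]_p) : Prop :=
  forall i, weak_derivatives vol (ch i @` (Omega `&` V i)) (Num.truncn alpha)
    (u \o chart_inv (ch i)) !=set0.

Lemma Lr_norm_le_Wnorm (alpha r : R) U (u : X -> 'rV[R[i]]_p) :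
  (Lr_norm mu U r u <= Wnorm mu vol ch V alpha U r u)%E.
Proof.
by rewrite /Wnorm leeDl// sume_ge0// => i _; exact: sobolev_norm_ge0.
Qed.

Lemma sobolev_norm_le_Wnorm (alpha r : R) U (u : X -> 'rV[R[i]]_p) i :
  (sobolev_norm vol (ch i @` (U `&` V i)) alpha r (u \o chart_inv (ch i)) <=
   Wnorm mu vol ch V alpha U r u)%E.
Proof.
rewrite /Wnorm (bigD1 i)//= addeCA leeDl// adde_ge0 ?Lr_norm_ge0//.
by apply: sume_ge0 => j _; exact: sobolev_norm_ge0.
Qed.

Lemma Wnorm_has_chart_derivatives (alpha r : R) (u : X -> 'rV[R[i]]_p) :
  (Wnorm mu vol ch V alpha Omega r u < +oo)%E -> has_chart_derivatives alpha u.
Proof.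
move=> fin i; apply: contrapT => W0.
have := le_lt_trans (sobolev_norm_le_Wnorm alpha r Omega u i) fin.
by rewrite /sobolev_norm asboolF.
Qed.

(** Two points of [Omega] with close images in a chart are close in [X]
   (uniform continuity), hence in a common [B j] (Lebesgue number [lambda]):
   the images of the pieces satisfy the condition on close pairs. *)
Lemma Wnorm_cover_le (k : nat) (B : 'I_k -> set X) (lambda alpha r : R) :
  (forall j, open (B j) /\ B j `<=` Omega) -> 0 < lambda ->
  (forall a, Omega a -> exists j, ball a lambda `&` Omega `<=` B j) ->
  0 <= alpha -> 0 < r ->
  exists2 C : R, 0 < C & forall (u : X -> 'rV[R[i]]_p) (M : R), 0 <= M ->
    has_chart_derivatives alpha u -> (Lr_norm mu Omega r u <= M%:E)%E ->
    (forall j, Wnorm mu vol ch V alpha (B j) r u <= M%:E)%E ->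
    (Wnorm mu vol ch V alpha Omega r u <= (C * M)%:E)%E.
Proof.
move=> oB lambda0 cov alpha0 r0; have [chV _] := cover.
have chart_bound i : exists C : R, 0 < C /\
    forall (u : X -> 'rV[R[i]]_p) (M : R), 0 <= M ->
      has_chart_derivatives alpha u ->
      (forall j, Wnorm mu vol ch V alpha (B j) r u <= M%:E)%E ->
      (sobolev_norm vol (ch i @` (Omega `&` V i)) alpha r
         (u \o chart_inv (ch i)) <= (C * M)%:E)%E.
  have [_ oV cV Vd] := chV i.
  have Vd' : V i `<=` chart_dom (ch i).
    by apply: subset_trans Vd; exact: subset_closure.
  have oI U : open U -> measurable (ch i @` (U `&` V i) : set (borel 'rV[R]_n)).
    move=> oU; apply: sub_sigma_algebra; apply: chart_image_open; first exact: openI.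
    by move=> x [_ /Vd'].
  have [delta delta0 close] := chart_inv_uniform cV Vd lambda0.
  have fin : (vol (ch i @` (Omega `&` V i)) < +oo)%E.
    apply: lebesgue_bounded_finite => //; first exact: oI.
    have := compact_bounded (chart_image_compact cV Vd).
    move=> [M0 [rM0 HM0]]; exists M0; split=> // M /HM0 HM _ [x [_ Vx] <-].
    apply: HM; exists x => //.
    exact: subset_closure.
  have [|j||C C0 HC] := @sobolev_norm_cover_le R n vol p k
    (fun j => ch i @` (B j `&` V i)) _ delta alpha r (oI _ oOmega) fin _ _
    delta0 _ alpha0 r0.
  - by move=> j; apply: oI; exact: (oB j).1.
  - apply: image_subset => x [Bx Vx]; split=> //; exact: (oB j).2.
  - move=> _ _ [a [Oa Va] <-] [b [Ob Vb] <-] ab.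
    have [j Hj] := cov _ Oa; exists j; split.
      by exists a => //; split=> //; apply: Hj; split=> //; exact: ballxx.
    exists b => //; split=> //; apply: Hj; split=> //.
    by apply: close => //; exact: subset_closure.
  exists C; split=> // u M M0 du WM; apply: HC => // j.
  exact: le_trans (sobolev_norm_le_Wnorm _ _ _ _ _) (WM j).
have [C HC] := boolp.choice chart_bound.
have C0 i : 0 < C i by have [] := HC i.
exists (1 + \sum_(i < m) C i).
  by rewrite ltr_wpDr// sumr_ge0// => i _; exact: ltW.
move=> u M M0 du uM WM; rewrite mulrDl mul1r EFinD; apply: leeD => //.
rewrite mulr_suml -sumEFin; apply: lee_sum => i _.
exact: (HC i).2.
Qed.

End Manifold_cover.

Theorem theorem2p1 (R : realType) (X : completeMetricType R)
    (mu : {measure set (borel X) -> \bar R})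
    (Omega : set X) (p : nat) (D : operator mu p)
    (tau s s' : R) (K : set (X -> 'rV[R[i]]_p)) :
  sigma_finite setT mu ->
  Omega !=set0 -> open Omega -> connected Omega -> compact (closure Omega) ->
  (mu Omega < +oo)%E ->
  (0 < p)%N -> 0 < tau -> 1 < s -> s^-1 + s'^-1 = 1 ->
  subspace_of K (Lr_space mu Omega s') ->
  local_increasing_regularity D Omega tau s ->
  global_resolvability D Omega (Lr_norm mu Omega s) s K ->
  (forall r, s <= r -> 0 < r^-1 - tau ->
     exists2 cf : R, 0 < cf &
       forall omega, Lr_space mu Omega r omega ->
         orthogonal_to mu Omega omega K ->
         exists u,
           [/\ Lr_space mu Omega (r^-1 - tau)^-1 u,
               solves D Omega u omega &
               (Lr_norm mu Omega (r^-1 - tau)^-1 u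
                <= cf%:E * Lr_norm mu Omega r omega)%E])
  /\
  (forall (n m : nat) (vol : {measure set (borel 'rV[R]_n) -> \bar R})
      (A : set (chart R X n)) (ch : 'I_m -> chart R X n) (V : 'I_m -> set X)
      (alpha : R),
     (0 < n)%N -> is_lebesgue vol -> smooth_atlas A ->
     chart_cover A Omega ch V -> 0 < alpha ->
     local_sobolev_regularity vol ch V D Omega alpha s ->
     global_resolvability D Omega (Wnorm mu vol ch V alpha Omega s)
       s K ->
     forall r, s <= r -> 0 < r^-1 - tau ->
     exists2 c : R, 0 < c &
       forall omega, Lr_space mu Omega r omega ->
         orthogonal_to mu Omega omega K ->
         exists u,
           [/\ Lr_space mu Omega (r^-1 - tau)^-1 u,
               solves D Omega u omega,
               (Lr_norm mu Omega (r^-1 - tau)^-1 u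
                <= c%:E * Lr_norm mu Omega r omega)%E,
               Wspace mu vol ch V alpha Omega r u &
               (Wnorm mu vol ch V alpha Omega r u
                <= c%:E * Lr_norm mu Omega r omega)%E]).
Proof.
move=> _ Omega0 oOmega _ cOmega fOmega _ tau0 s1 _ _ lir glob.
have finE r (omega : X -> 'rV[R[i]]_p) : Lr_space mu Omega r omega ->
    exists2 M : R, 0 <= M & Lr_norm mu Omega r omega = M%:E.
  move=> [_ fin]; exists (fine (Lr_norm mu Omega r omega)).
    by rewrite fine_ge0// Lr_norm_ge0.
  by rewrite fineK// ge0_fin_numE// Lr_norm_ge0.
split=> [r sr rtau|].
  have [C C0 HC] := resolvability_bootstrap Omega0 oOmega cOmega fOmega tau0 s1
    sr rtau lir (fun w => lexx _) glob.
  exists C => // omega So perp; have [w [sol mw _ _ wt]] := HC omega So perp.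
  exists w; split=> //; split=> //; apply: le_lt_trans wt _.
  by have [M _ ->] := finE _ _ So; rewrite -EFinM ltry.
move=> n m vol A ch V alpha _ leb _ cover alpha0 lsr globW r sr rtau.
have r0 : 0 < r by apply: lt_le_trans sr; exact: lt_trans s1.
have [C C0 HC] := resolvability_bootstrap Omega0 oOmega cOmega fOmega tau0 s1
  sr rtau lir (fun w => Lr_norm_le_Wnorm mu vol ch V alpha s Omega w) globW.
(* The local Sobolev estimates, now usable since [w] is bounded in L^r. *)
have [x Ox|k [B [lambda [Cl [lambda0 Cl0 oB cov est]]]]] :=
    uniform_local_estimate (N := fun B1 => Wnorm mu vol ch V alpha B1 r)
      (D := D) (mu := mu) Omega0 oOmega cOmega r0.
  by have [rho rho0 [_ _ H]] := lsr x Ox; exists rho => //; exact: H.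
have [Cw Cw0 HW] := Wnorm_cover_le mu p leb cover oOmega oB lambda0 cov
  (ltW alpha0) r0.
exists (C + Cw * ((Cl + 1) * (C + 1))).
  by rewrite addr_gt0// !mulr_gt0// addr_gt0.
move=> omega So perp; have [w [sol mw Ww wr wt]] := HC omega So perp.
have [M M0 ME] := finE _ _ So.
have momega := So.1.
rewrite ME -EFinM in wr wt *.
have CM0 : 0 <= (C + 1) * M by rewrite mulr_ge0// addr_ge0// ltW.
have wr' : (Lr_norm mu Omega r w <= ((C + 1) * M)%:E)%E.
  by apply: le_trans wr _; rewrite lee_fin ler_wpM2r// lerDl.
have or' : (Lr_norm mu Omega r omega <= ((C + 1) * M)%:E)%E.
  by rewrite ME lee_fin ler_peMl// lerDr ltW.
have WM : (Wnorm mu vol ch V alpha Omega r w <=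
    (Cw * ((Cl + 1) * ((C + 1) * M)))%:E)%E.
  apply: HW.
  - by rewrite mulr_ge0// addr_ge0// ltW.
  - exact: Wnorm_has_chart_derivatives Ww.
  - apply: le_trans wr' _.
    by rewrite lee_fin ler_peMl// lerDr ltW.
  - move=> j; apply: le_trans (est j w omega _ CM0 sol mw momega wr' or') _.
    by rewrite lee_fin ler_wpM2r// lerDl.
have WC : (Wnorm mu vol ch V alpha Omega r w <=
    ((C + Cw * ((Cl + 1) * (C + 1))) * M)%:E)%E.
  apply: le_trans WM _; rewrite lee_fin [leRHS]mulrDl !mulrA lerDr.
  by rewrite mulr_ge0// ltW.
have Wfin := le_lt_trans WC (ltry _).
exists w; rewrite -EFinM; split=> //.
- by split=> //; exact: le_lt_trans wt (ltry _).
- apply: le_trans wt _; rewrite lee_fin mulrDl lerDl.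
  by rewrite mulr_ge0// mulr_ge0 ?mulr_ge0 ?addr_ge0 ?ltW.
- split=> //; split=> //; exact: le_lt_trans wr (ltry _).
Qed.
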